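(* Let $[A]_D\in\mathbb{R}^{N\times N}[T]/(T^D)$ be a symmetric matrix polynomial, let $0\le d\le D-1$, and let $[\Lambda^d]_D,[Q^d]_D=\mathrm{eigh}_d([A]_D)$ be a solution of the relaxed problem of level $d$ and order $D$ for $[A]_D$, with block vector $b^d$ and $N_b^d$ blocks. For every $n_b=1,\dots,N_b^d$, with slice indices $s=b^d_{n_b}:b^d_{n_b+1}-1$, let $$[\hat\Lambda_{s,s}]_{D-d},\ [\hat Q_{s,s}]_{D-d}\overset{D-d}{=}\mathrm{eigh}_1\bigl([\Lambda^d_{s,s}]_{d:}\bigr),$$ and let all other elements of $[\hat Q]_{D-d}$ and $[\hat\Lambda]_{D-d}$ be zero, i.e. $[\hat Q]_{D-d}$ and $[\hat\Lambda]_{D-d}$ are block diagonal. Then a solution of $$[\Lambda^{d+1}]_D,[Q^{d+1}]_D\overset{D}{=}\mathrm{eigh}_{d+1}([A]_D),$$ i.e. of the relaxed problem of level $d+1$ and order $D$ for $[A]_D$, is given by $$[\Lambda^{d+1}]_D\overset{D}{=}[\Lambda^d]_d+[\hat\Lambda]_{D-d}T^d,\qquad [Q^{d+1}]_D\overset{D}{=}[Q^d]_D[Q]_D,$$ where $[Q]_D=[\hat Q]_{D-d}+[\Delta Q]_dT^{D-d}$ for some $[\Delta Q]_d$ (i.e. there exists such a $[\Delta Q]_d$) satisfying $$0\overset{D}{=}[Q]_D^T[Q]_D-I .$$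
   Context: An element of $\mathbb{R}^{N\times N}[T]/(T^D)$ is written $[X]_D=\sum_{k=0}^{D-1}X_kT^k$. For $K\le D$, $[X]_K$ is the truncation $\sum_{k=0}^{K-1}X_kT^k$ (zero if $K=0$), and $[X]_{d:}=\sum_{k=d}^{D-1}X_kT^{k-d}$ is the shifted tail, an element of order $D-d$. $[X]\overset{K}{=}[Y]$ means $X_k=Y_k$ for $k=0,\dots,K-1$ (equality modulo $T^K$; vacuous for $K=0$). Truncations are identified with their representing polynomials when used in relations of higher order. $(P_L)_{ij}=1$ if $j<i$ and $0$ otherwise; $(P_R)_{ij}=1$ if $i<j$ and $0$ otherwise; $\circ$ is the elementwise product, applied coefficientwise. $i:j$ denotes the index range $i,i+1,\dots,j$, and $X_{s,s}$ the corresponding diagonal submatrix. Relaxed problem of level $d$ and order $D$ for symmetric $[A]_D$: find $[\Lambda^d]_D,[Q^d]_D\in\mathbb{R}^{N\times N}[T]/(T^D)$ with $$0\overset{D}{=}[Q^d]_D^T[A]_D[Q^d]_D-[\Lambda^d]_D,\quad 0\overset{D}{=}[Q^d]_D^T[Q^d]_D-I,\quad 0\overset{d}{=}(P_L+P_R)\circ[\Lambda^d]_d,\quad 0\overset{D}{=}P_b^d\circ[\Lambda^d]_D .$$ So the first $d$ coefficients of $[\Lambda^d]_D$ are diagonal and the higher ones are block diagonal. A solution is denoted $[\Lambda^d]_D,[Q^d]_D=\mathrm{eigh}_d([A]_D)$; it need not be unique. The truncated diagonal entries $[\Lambda^d_{jj}]_d$ are assumed sorted (lexicographically in their coefficients of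 orders $0,1,\dots,d-1$), so that entries equal modulo $T^d$ are consecutive. $N_b^d$ is the number of distinct values among $[\Lambda^d_{11}]_d,\dots,[\Lambda^d_{NN}]_d$, and $b^d\in\mathbb{N}^{N_b^d+1}$ is the vector with $b^d_1=1$, $b^d_{N_b^d+1}=N+1$ whose differences $b^d_{n_b+1}-b^d_{n_b}$ are the multiplicities of the successive distinct values. The matrix $P_b^d$ has $(P_b^d)_{ij}=0$ if $i,j$ lie in the same block $\{b^d_{n_b},\dots,b^d_{n_b+1}-1\}$ for some $n_b$, and $(P_b^d)_{ij}=1$ otherwise. For $d=0$: $b^0=[1,N+1]$ (a single block), $[Q^0]_D:=I$, $[\Lambda^0]_D:=[A]_D$. $\mathrm{eigh}_1$ applied to a symmetric matrix polynomial of order $D-d$ (of the size of the block) denotes a solution of its relaxed problem of level $1$ and order $D-d$. *)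

(* Defs.v *)
From HB Require Import structures.
From mathcomp Require Import all_boot all_order all_algebra reals.
Set Implicit Arguments.
Unset Strict Implicit.
Unset Printing Implicit Defensive.
Import Order.TTheory GRing.Theory Num.Theory.
Local Open Scope ring_scope.

(* R^{N x N}[T] is identified with 'M[{poly R}]_N, which is meaningful for every
   N, whereas {poly 'M[R]_N} needs N to be a successor.  An element of
   R^{N x N}[T]/(T^D) is given by any representative 'M[{poly R}]_N: all the
   notions below only see it through eq_mod D.  Indices of rows, columns and
   blocks start from 0. *)

Section MatrixPolynomials.
Variables (R : realType) (m n : nat).
Implicit Types (X Y : 'M[{poly R}]_(m, n)) (K k d : nat).

Definition mxcoef k X : 'M[R]_(m, n) := map_mx (coefp k) X.

Definition eq_mod K X Y : Prop := forall k, (k < K)%N -> mxcoef k X = mxcoef k Y.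

(* [X]_K, seen as a polynomial of degree < K *)
Definition mxtrunc K X : 'M[{poly R}]_(m, n) := map_mx (take_poly K) X.

(* [X]_{d:} *)
Definition mxtail d X : 'M[{poly R}]_(m, n) := map_mx (drop_poly d) X.

Definition hadamard (P : 'M[R]_(m, n)) X : 'M[{poly R}]_(m, n) :=
  \matrix_(i, j) (P i j *: X i j).

End MatrixPolynomials.

Definition P_L (R : realType) (N : nat) : 'M[R]_N := \matrix_(i, j) ((j < i)%N)%:R.
Definition P_R (R : realType) (N : nat) : 'M[R]_N := \matrix_(i, j) ((i < j)%N)%:R.

Section Blocks.
Variables (R : realType) (N d : nat).
Implicit Types (L X : 'M[{poly R}]_N) (nb : nat).

(* Lexicographic comparison of the coefficients of orders 0, ..., d-1. *)
Definition lex_le (p q : {poly R}) : bool :=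
  ((mkseq (nth 0 p) d : seqlexi R) <= mkseq (nth 0 q) d)%O.

Definition diag_sorted L : Prop :=
  forall i j : 'I_N, (i <= j)%N -> lex_le (L i i) (L j j).

Definition diag_vals L : seq {poly R} := [seq take_poly d (L i i) | i <- enum 'I_N].

(* When diag_sorted L holds, equal values are consecutive in diag_vals L and
   undup lists the distinct ones in their order of appearance. *)
Definition diag_distinct L : seq {poly R} := undup (diag_vals L).

Definition nblocks L : nat := size (diag_distinct L).

(* b_0 = 0, ..., b_{nblocks L} = N; the block nb is b_nb, ..., b_{nb+1} - 1. *)
Definition bvec L nb : nat :=
  (\sum_(v <- take nb (diag_distinct L)) count_mem v (diag_vals L))%N.

Definition in_block L nb (i : 'I_N) : bool := (bvec L nb <= i < bvec L nb.+1)%N.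

Definition same_block L (i j : 'I_N) : bool :=
  [exists nb : 'I_(nblocks L), in_block L nb i && in_block L nb j].

Definition P_b L : 'M[R]_N := \matrix_(i, j) (~~ same_block L i j)%:R.

Lemma bvec_le L nb : (bvec L nb <= N)%N.
Proof.
have sizeN : size (diag_vals L) = N by rewrite size_map size_enum_ord.
rewrite -[X in (_ <= X)%N]sizeN -(@sum1_size _ (diag_vals L)).
rewrite -big_undup_iterop_count.
rewrite /bvec -[X in (_ <= \sum_(v <- X) _)%N](cat_take_drop nb) big_cat /=.
have it1 k : iterop k addn 1%N 0%N = k by elim: k => [|[|k] IH] //; rewrite -[in RHS]IH.
by under [X in (_ <= X + _)%N]eq_bigr do rewrite it1; apply: leq_addr.
Qed.

Definition bsize L nb : nat := (bvec L nb.+1 - bvec L nb)%N.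

Lemma slice_subproof L nb (i : 'I_(bsize L nb)) : (bvec L nb + i < N)%N.
Proof.
by apply: leq_trans (bvec_le L nb.+1); rewrite -ltn_subRL; exact: ltn_ord i.
Qed.

Definition slice L nb (i : 'I_(bsize L nb)) : 'I_N := Ordinal (slice_subproof i).

(* X_{s,s} for s the index range of the block nb of L *)
Definition block_sub L nb X : 'M[{poly R}]_(bsize L nb) :=
  mxsub (@slice L nb) (@slice L nb) X.

End Blocks.

(* (L, Q) is a solution eigh_d([A]_D) of the relaxed problem of level d and
   order D.  Solutions are not unique, hence a relation.  At level 0, where the
   equations would admit any orthogonal Q, the solution is by convention
   Q = I, L = A. *)
Record is_eigh (R : realType) (N D d : nat) (A L Q : 'M[{poly R}]_N) : Prop := IsEigh {
  eigh_diag   : eq_mod D 0 (Q^T *m A *m Q - L);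
  eigh_orth   : eq_mod D 0 (Q^T *m Q - 1%:M);
  eigh_low    : eq_mod d 0 (hadamard (P_L R N + P_R R N) (mxtrunc d L));
  eigh_block  : eq_mod D 0 (hadamard (P_b d L) L);
  eigh_sorted : diag_sorted d L;
  eigh_level0 : d = 0%N -> eq_mod D Q 1%:M /\ eq_mod D L A
}.

(* Main.v *)
Require Import Defs.
From mathcomp Require Import all_boot all_order all_algebra reals.
From mathcomp Require Import ring.
Set Implicit Arguments.
Unset Strict Implicit.
Unset Printing Implicit Defensive.
Import Order.TTheory GRing.Theory Num.Theory.
Local Open Scope ring_scope.

(** Write [Lam] = L0 + T^d M, where L0 is the truncation at order d.  The two
    factors behave well for opposite reasons.  L0 is diagonal, and on each block
    its diagonal is constant, so every matrix that is block diagonal commutes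
    with it ([trunc_Lam_comm]).  M comes with a factor T^d, so modulo T^D it only
    sees the first D - d coefficients of whatever it is multiplied by.

    Let U be the truncation of Q_hat at order D - d.  Assembling the blocks, U is
    orthogonal and diagonalises M, both modulo T^(D - d) ([Q_hat_orth],
    [Q_hat_diagonalises_tail]).  Orthogonality is then lifted to order D by the
    Newton-Schulz iteration W <- W (1 - (W^T W - 1) / 2): it gains at least one
    order per step, does not touch the orders that are already right, and only
    uses W and its transpose, so that it stays inside the commutant of L0
    ([orth_lift]).  The correction dQ is the part of the lifted matrix from order
    D - d on, and Q_step is the lifted matrix modulo T^D.  Hence, modulo T^D,

      Q_step^T Lam Q_step = L0 Q_step^T Q_step + T^d U^T M U = L0 + T^d Lam_hat,

    which is [Lam_next_diagonalised].

    What remains is combinatorial.  The block vector is defined by counting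
    multiplicities; for a sorted diagonal, two indices are in the same block
    exactly when their truncated diagonal entries agree ([same_blockE]).  The
    lexicographic order at order d + 1 refines that at order d by comparing one
    more coefficient ([lex_leS]), which for Lam_next is the constant coefficient
    of Lam_hat.  So each block of level d + 1 is a block of level 1 inside a block
    of level d, and the sorting and block conditions of level d + 1 follow from
    those of level d and of the subproblems. *)

(** * Congruence modulo a power of T *)

Section Congruence.
Variable R : realType.

Lemma eq_mod_coefP m n K (X Y : 'M[{poly R}]_(m, n)) :
  eq_mod K X Y <-> forall i j k, (k < K)%N -> (X i j)`_k = (Y i j)`_k.
Proof.
split=> [XY i j k kK | XY k kK]; last first.
  by apply/matrixP => i j; rewrite !mxE; exact: XY.
by have /matrixP/(_ i j) := XY k kK; rewrite !mxE.
Qed.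

Lemma eq_modP m n K (X Y : 'M[{poly R}]_(m, n)) :
  eq_mod K X Y <-> exists Z, X = Y + 'X^K *: Z.
Proof.
split=> [/eq_mod_coefP XY | [Z ->]]; last first.
  by apply/eq_mod_coefP => i j k kK; rewrite !mxE coefD coefXnM kK addr0.
exists (mxtail K (X - Y)); apply/matrixP => i j; rewrite !mxE.
apply/polyP => k; rewrite coefD coefXnM coef_drop_poly coefB.
case: ltnP => [kK | Kk]; first by rewrite addr0 XY.
by rewrite subnK // addrC subrK.
Qed.

Lemma eq_mod_refl m n K (X : 'M[{poly R}]_(m, n)) : eq_mod K X X.
Proof. by []. Qed.

Lemma eq_mod_sym m n K (X Y : 'M[{poly R}]_(m, n)) :
  eq_mod K X Y -> eq_mod K Y X.
Proof. by move=> XY k kK; rewrite XY. Qed.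

Lemma eq_mod_trans m n K (Y X Z : 'M[{poly R}]_(m, n)) :
  eq_mod K X Y -> eq_mod K Y Z -> eq_mod K X Z.
Proof. by move=> XY YZ k kK; rewrite XY // YZ. Qed.

Lemma eq_mod_leq m n K K' (X Y : 'M[{poly R}]_(m, n)) :
  (K <= K')%N -> eq_mod K' X Y -> eq_mod K X Y.
Proof. by move=> KK' XY k kK; apply: XY; exact: leq_trans kK KK'. Qed.

Lemma eq_modD m n K (X X' Y Y' : 'M[{poly R}]_(m, n)) :
  eq_mod K X X' -> eq_mod K Y Y' -> eq_mod K (X + Y) (X' + Y').
Proof.
move=> /eq_modP[V ->] /eq_modP[W ->]; apply/eq_modP; exists (V + W).
by rewrite scalerDr addrACA.
Qed.

Lemma eq_modM m n p K (X X' : 'M[{poly R}]_(m, n)) (Y Y' : 'M[{poly R}]_(n, p)) :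
  eq_mod K X X' -> eq_mod K Y Y' -> eq_mod K (X *m Y) (X' *m Y').
Proof.
move=> /eq_modP[V ->] /eq_modP[W ->]; apply/eq_modP.
exists (V *m (Y' + 'X^K *: W) + X' *m W).
by rewrite mulmxDl (mulmxDr X') -scalemxAl -scalemxAr scalerDr addrAC addrA.
Qed.

Lemma eq_mod_tr m n K (X Y : 'M[{poly R}]_(m, n)) :
  eq_mod K X Y -> eq_mod K X^T Y^T.
Proof.
move=> /eq_mod_coefP XY; apply/eq_mod_coefP => i j k kK.
by rewrite !mxE XY.
Qed.

Lemma eq_modXn m n d K (X Y : 'M[{poly R}]_(m, n)) :
  eq_mod K X Y -> eq_mod (d + K) ('X^d *: X) ('X^d *: Y).
Proof.
move=> /eq_modP[V ->]; apply/eq_modP; exists V.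
by rewrite scalerDr scalerA exprD.
Qed.

Lemma eq_mod_sub0 m n K (X Y : 'M[{poly R}]_(m, n)) :
  eq_mod K 0 (X - Y) <-> eq_mod K X Y.
Proof.
split=> [XY | XY].
  by have := eq_modD (eq_mod_sym XY) (eq_mod_refl (K:=K) Y); rewrite subrK add0r.
by have := eq_modD (eq_mod_sym XY) (eq_mod_refl (K:=K) (- Y)); rewrite subrr.
Qed.

Lemma eq_mod_trunc m n K (X : 'M[{poly R}]_(m, n)) : eq_mod K (mxtrunc K X) X.
Proof.
by apply/eq_mod_coefP => i j k kK; rewrite !mxE coef_take_poly kK.
Qed.

Lemma mxtrunc_tail m n K (X : 'M[{poly R}]_(m, n)) :
  X = mxtrunc K X + 'X^K *: mxtail K X.
Proof.
by apply/matrixP => i j; rewrite !mxE mulrC poly_take_drop.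
Qed.

(** Taken at D - d, this splits an orthogonal lift modulo T^D into the
    prescribed low part and the correction dQ. *)
Lemma mxtrunc_split m n K D (X : 'M[{poly R}]_(m, n)) : (K <= D)%N ->
  mxtrunc D X = mxtrunc K X + 'X^K *: mxtrunc (D - K) (mxtail K X).
Proof.
move=> KD; apply/matrixP => i j; rewrite !mxE; apply/polyP => k.
rewrite coefD coefXnM !coef_take_poly coef_drop_poly.
case: (ltnP k K) => [kK | Kk]; first by rewrite addr0 (leq_trans kK KD).
by rewrite add0r subnK // ltn_sub2rE.
Qed.

Lemma eq_mod_mxtrunc m n K (X Y : 'M[{poly R}]_(m, n)) :
  eq_mod K X Y -> mxtrunc K X = mxtrunc K Y.
Proof.
move=> /eq_mod_coefP XY; apply/matrixP => i j; rewrite !mxE.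
by apply/polyP => k; rewrite !coef_take_poly; case: ltnP => // /XY.
Qed.

End Congruence.

(** * Lifting orthogonality to higher order *)

Section Lifting.
Variables (R : realType) (N : nat).
Implicit Types X U : 'M[{poly R}]_N.

Definition half_poly : {poly R} := (2%:R^-1)%:P.

(** One step of the Newton-Schulz iteration for the orthogonal polar factor. *)
Definition newton_step U : 'M[{poly R}]_N := U *m (1%:M - half_poly *: (U^T *m U - 1%:M)).

Lemma half_polyD X : half_poly *: X + half_poly *: X = X.
Proof.
rewrite -scalerDl -polyCD.
by have -> : 2%:R^-1 + 2%:R^-1 = 1 :> R; [field | rewrite scale1r].
Qed.

Lemma newton_step_eq_mod K U :
  eq_mod K (U^T *m U) 1%:M -> eq_mod K (newton_step U) U.
Proof.
move=> /eq_modP[Z UU]; apply/eq_modP; exists (- (U *m (half_poly *: Z))).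
rewrite /newton_step UU addrAC subrr add0r mulmxBr mulmx1 !scalerA mulrC -scalerA.
by rewrite -scalemxAr scalerN.
Qed.

(** With U^T U = 1 + 2H, the new Gram matrix is
    (1 - H) (1 + 2H) (1 - H) = 1 + H^2 (2H - 3), and H^2 vanishes to order 2K,
    which is at least K + 1. *)
Lemma newton_step_orth K U : (0 < K)%N ->
  eq_mod K (U^T *m U) 1%:M ->
  eq_mod K.+1 ((newton_step U)^T *m newton_step U) 1%:M.
Proof.
move=> K_gt0 /eq_modP[Z UU]; rewrite /newton_step.
set H := half_poly *: (U^T *m U - 1%:M).
have UUE : U^T *m U = 1%:M + (H + H) by rewrite half_polyD addrC subrK.
have HT : H^T = H.
  by rewrite /H linearZ linearB /= trmx1 trmx_mul trmxK.
have HE : H = 'X^K *: (half_poly *: Z).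
  by rewrite /H UU addrAC subrr add0r !scalerA mulrC.
rewrite trmx_mul linearB /= trmx1 HT mulmxA -(mulmxA _ U^T) UUE.
have -> : (1%:M - H) *m (1%:M + (H + H)) *m (1%:M - H) =
    1%:M + H *m H *m (H + H - 1%:M - 1%:M - 1%:M).
  rewrite !(mulmxDl, mulmxDr, mulNmx, mulmxN) !(mul1mx, mulmx1) ?mulmxA.
  apply/matrixP => i j; move: (H *m H *m H) (H *m H) => HHH HH.
  by rewrite !mxE; ring.
rewrite {1 2}HE -scalemxAl -scalemxAr scalerA -exprD.
apply: (@eq_mod_leq _ _ _ _ (K + K)); first by rewrite -addn1 leq_add2l.
apply/eq_modP; exists (half_poly *: Z *m (half_poly *: Z) *m (H + H - 1%:M - 1%:M - 1%:M)).
by rewrite -scalemxAl.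
Qed.

(** The matrix C stands for the low order eigenvalues: the lift must not destroy
    the fact that U commutes with them.  Symmetry of C makes the transpose of
    each iterate commute with C too. *)
Lemma orth_lift (C : 'M[{poly R}]_N) K D U :
  C^T = C -> C *m U = U *m C -> (0 < K)%N -> eq_mod K (U^T *m U) 1%:M ->
  exists W, [/\ eq_mod K W U, C *m W = W *m C & eq_mod D (W^T *m W) 1%:M].
Proof.
move=> CT CU K_gt0 UU.
suff [W [WU CW WW]] : exists W, [/\ eq_mod K W U, C *m W = W *m C
    & eq_mod (K + D) (W^T *m W) 1%:M].
  by exists W; split=> //; exact: eq_mod_leq (leq_addl K D) WW.
elim: D => [|D [W [WU CW WW]]]; first by exists U; rewrite addn0; split.
exists (newton_step W); split.
- apply: eq_mod_trans WU; apply: newton_step_eq_mod.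
  exact: eq_mod_leq (leq_addr D K) WW.
- have CWT : C *m W^T = W^T *m C.
    by rewrite -{1}CT -trmx_mul -CW trmx_mul CT.
  rewrite /newton_step mulmxA CW -!mulmxA; congr (W *m _).
  rewrite mulmxBr mulmxBl mulmx1 mul1mx -scalemxAl -scalemxAr.
  by rewrite mulmxBr mulmxBl mulmx1 mul1mx mulmxA CWT -!mulmxA CW.
- by rewrite addnS; apply: newton_step_orth => //; rewrite addn_gt0 K_gt0.
Qed.

End Lifting.

(** * Lexicographic comparison of coefficients *)

Section LexOrder.
Variable R : realType.
Implicit Types p q r : {poly R}.

Lemma lexi_rcons (s t : seq R) (x y : R) : size s = size t ->
  ((rcons s x : seqlexi R) <= rcons t y)%O =
  ((s : seqlexi R) <= t)%O && ((s == t) ==> (x <= y)).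
Proof.
elim: s t => [|a s IHs] [|b t] //= => [_|[st]].
  by rewrite lexi_cons !lexi0s implybT andbT.
by rewrite !lexi_cons IHs // eqseq_cons; case: (ltgtP a b).
Qed.

Lemma mkseq_coef_eq d p q :
  (mkseq (nth 0 p) d == mkseq (nth 0 q) d) = (take_poly d p == take_poly d q).
Proof.
apply/eqP/eqP => [pq | pq].
  apply/polyP => k; rewrite !coef_take_poly; case: ltnP => // kd.
  by rewrite -(nth_mkseq 0 (nth 0 p) kd) pq nth_mkseq.
apply: (@eq_from_nth _ 0) => [|k]; rewrite !size_mkseq // => kd.
by rewrite !nth_mkseq //; have := congr1 (coefp k) pq; rewrite /= !coef_take_poly kd.
Qed.

Lemma take_polyS_eq n p q :
  take_poly n p = take_poly n q -> p`_n = q`_n ->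
  take_poly n.+1 p = take_poly n.+1 q.
Proof.
move=> pq pqn; apply/polyP => k; rewrite !coef_take_poly ltnS leq_eqVlt.
have [->|_] /= := eqVneq k n; first exact: pqn.
by have := congr1 (coefp k) pq; rewrite /= !coef_take_poly.
Qed.

Lemma lex_leS d p q :
  lex_le d.+1 p q = lex_le d p q && ((take_poly d p == take_poly d q) ==> (p`_d <= q`_d)).
Proof.
by rewrite /lex_le !mkseqS lexi_rcons ?size_mkseq // mkseq_coef_eq.
Qed.

Lemma lex_le_trans d : transitive (@lex_le R d).
Proof. by move=> q p r; rewrite /lex_le; exact: le_trans. Qed.

(** Sorting only determines polynomials up to truncation, so antisymmetry holds
    for the truncations. *)
Lemma lex_le_anti d p q :
  lex_le d p q -> lex_le d q p -> take_poly d p = take_poly d q.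
Proof.
move=> pq qp; apply/eqP; rewrite -mkseq_coef_eq.
by apply/eqP; apply: (@le_anti _ (seqlexi R)); apply/andP.
Qed.

Lemma take_poly_idem d p : take_poly d (take_poly d p) = take_poly d p.
Proof. by apply: take_poly_id; exact: size_take_poly. Qed.

Lemma lex_le_take d p q : lex_le d (take_poly d p) (take_poly d q) = lex_le d p q.
Proof.
have mkseq_take r : mkseq (nth 0 (take_poly d r)) d = mkseq (nth 0 r) d.
  by apply/eqP; rewrite mkseq_coef_eq take_poly_idem.
by rewrite /lex_le !mkseq_take.
Qed.

End LexOrder.

(** * Blocks of a sorted diagonal *)

Section Blocks.
Variables (R : realType) (N d : nat) (L : 'M[{poly R}]_N).
Hypothesis L_sorted : diag_sorted d L.

Let diag_val (i : 'I_N) := take_poly d (L i i).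
Let block_rank (i : 'I_N) := index (diag_val i) (diag_distinct d L).

Lemma nth_diag_vals (i : 'I_N) : nth 0 (diag_vals d L) i = diag_val i.
Proof.
by rewrite (nth_map i) ?size_enum_ord // nth_ord_enum.
Qed.

Lemma mem_diag_distinct i : diag_val i \in diag_distinct d L.
Proof. by rewrite mem_undup map_f ?mem_enum. Qed.

Lemma size_diag_vals : size (diag_vals d L) = N.
Proof. by rewrite size_map size_enum_ord. Qed.

Lemma diag_vals_sorted : sorted (lex_le d) (diag_vals d L).
Proof.
apply/(sortedP 0) => i; rewrite size_diag_vals => iN.
have := @L_sorted (Ordinal (ltnW iN)) (Ordinal iN) (leqnSn i).
by rewrite -lex_le_take -/(diag_val _) -/(diag_val _) -!nth_diag_vals.
Qed.

(** The list of distinct values is itself sorted, being a subsequence of a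
    sorted list; so a value that is not larger cannot be listed later. *)
Lemma block_rank_mono (i j : 'I_N) : (i <= j)%N -> (block_rank i <= block_rank j)%N.
Proof.
move=> ij; rewrite leqNgt; apply/negP => ltji.
have srt : sorted (lex_le d) (diag_distinct d L).
  apply: subseq_sorted diag_vals_sorted; first exact: lex_le_trans.
  exact: undup_subseq.
have := sorted_ltn_index (@lex_le_trans R d) srt _ _ (mem_diag_distinct j)
  (mem_diag_distinct i) ltji.
rewrite lex_le_take => ji; have ij' := L_sorted ij.
by move: ltji; rewrite /block_rank /diag_val (lex_le_anti ij' ji) ltnn.
Qed.

Lemma sum_count_mem (T : eqType) (t s : seq T) : uniq t ->
  (\sum_(v <- t) count_mem v s = count [in t] s)%N.
Proof.
elim: t => [|v t IHt] /=; first by rewrite big_nil (eq_count (a2 := pred0)) ?count_pred0.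
move=> /andP[vt ut]; rewrite big_cons IHt // -count_predUI.
rewrite [X in (_ + X)%N](eq_count (a2 := pred0)) ?count_pred0 ?addn0.
  by apply: eq_count => x /=; rewrite inE.
by move=> x /=; case: eqP => // ->; exact: negbTE.
Qed.

Lemma bvecE nb :
  bvec d L nb = count (fun k => k < nb)%N
    [seq index v (diag_distinct d L) | v <- diag_vals d L].
Proof.
rewrite /bvec sum_count_mem ?take_uniq ?undup_uniq // count_map.
by apply: eq_in_count => v vs /=; rewrite in_take ?mem_undup.
Qed.

(** By [bvecE], the bound of block nb is the number of indices of rank less than
    nb.  As ranks increase with the index, these indices form an initial
    segment. *)
Lemma ltn_bvec nb (i : 'I_N) : (i < bvec d L nb)%N = (block_rank i < nb)%N.
Proof.
rewrite bvecE; set s := map _ _.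
have sz : size s = N by rewrite size_map size_diag_vals.
have nths (j : 'I_N) : nth 0%N s j = block_rank j.
  by rewrite (nth_map 0) ?size_diag_vals // nth_diag_vals.
have srt : sorted <=%O s.
  apply/(sortedP 0%N) => j; rewrite sz => jN.
  rewrite (nths (Ordinal jN)) (nths (Ordinal (ltnW jN))).
  by apply: block_rank_mono; exact: leqnSn.
apply/idP/idP => [lti|].
  by rewrite -nths; exact: (nth_count_lt 0%N srt).
apply: contraTT; rewrite -!leqNgt => gei; rewrite -nths.
by apply: (nth_count_ge 0%N srt); rewrite gei sz ltn_ord.
Qed.

Lemma in_blockE nb (i : 'I_N) : in_block d L nb i = (block_rank i == nb).
Proof. by rewrite /in_block leqNgt !ltn_bvec -leqNgt ltnS eqn_leq andbC. Qed.

Lemma block_rank_lt i : (block_rank i < nblocks d L)%N.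
Proof. by rewrite index_mem mem_diag_distinct. Qed.

(** This turns the multiplicity-counting definition of blocks into an equality
    test; in particular being in the same block is an equivalence relation. *)
Lemma same_blockE (i j : 'I_N) :
  same_block d L i j = (take_poly d (L i i) == take_poly d (L j j)).
Proof.
apply/existsP/eqP => [[nb] | ij].
  rewrite !in_blockE => /andP[/eqP ri /eqP rj].
  rewrite -/(diag_val i) -/(diag_val j) -(nth_index 0 (mem_diag_distinct i)).
  by rewrite -/(block_rank i) ri -rj nth_index ?mem_diag_distinct.
exists (Ordinal (block_rank_lt i)); rewrite !in_blockE /=.
by rewrite eqxx /block_rank /diag_val ij eqxx.
Qed.

Lemma in_block_slice nb (i : 'I_(bsize d L nb)) : in_block d L nb (slice i).
Proof. by rewrite /in_block leq_addr /= -ltn_subRL ltn_ord. Qed.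

Lemma slice_inj nb : injective (@slice R N d L nb).
Proof. by move=> i j /(congr1 val) /addnI /val_inj. Qed.

Lemma slice_surj nb (i : 'I_N) : in_block d L nb i ->
  exists i' : 'I_(bsize d L nb), i = slice i'.
Proof.
move=> /andP[lei lti].
have lt' : (i - bvec d L nb < bsize d L nb)%N by rewrite ltn_sub2rE.
by exists (Ordinal lt'); apply/val_inj; rewrite /= subnKC.
Qed.

Lemma same_block_slice (i j : 'I_N) : same_block d L i j ->
  exists nb : 'I_(nblocks d L), exists i' j' : 'I_(bsize d L nb),
    i = slice i' /\ j = slice j'.
Proof.
move=> /existsP[nb /andP[/slice_surj[i' ->] /slice_surj[j' ->]]].
by exists nb, i', j'.
Qed.

(** Exact vanishing, not vanishing modulo a power of T: the truncated matrices
    satisfy it, and products can then be restricted to blocks without error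
    terms. *)
Definition block_diagonal (X : 'M[{poly R}]_N) : Prop :=
  forall i j, ~~ same_block d L i j -> X i j = 0.

Lemma block_diagonal_tr X : block_diagonal X -> block_diagonal X^T.
Proof.
by move=> Xb i j; rewrite same_blockE eq_sym -same_blockE mxE => /Xb.
Qed.

Lemma block_diagonalM X Y :
  block_diagonal X -> block_diagonal Y -> block_diagonal (X *m Y).
Proof.
move=> Xb Yb i j ij; rewrite mxE big1 // => k _.
have [ik|/Xb ->] := boolP (same_block d L i k); last by rewrite mul0r.
rewrite Yb ?mulr0 //; apply: contra ij.
by move: ik; rewrite !same_blockE => /eqP->.
Qed.

Lemma block_subM nb X Y : block_diagonal X ->
  block_sub d L nb (X *m Y) = block_sub d L nb X *m block_sub d L nb Y.
Proof.
move=> Xb; apply/matrixP => i j; rewrite !mxE.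
rewrite (bigID (in_block d L nb)) /= [X in _ + X]big1 ?addr0 => [|k knb].
  rewrite (eq_bigl [in [set slice k | k : 'I_(bsize d L nb)]]) => [|k].
    by rewrite big_imset; [under [RHS]eq_bigr do rewrite !mxE | move=> ? ? _ _ /slice_inj].
  apply/idP/imsetP => [/slice_surj[k' ->]|[k' _ ->]]; first by exists k'.
  exact: in_block_slice.
rewrite Xb ?mul0r //; apply: contra knb => /existsP[nb' /andP[]].
by have := in_block_slice i; rewrite !in_blockE => /eqP-> /eqP->.
Qed.

Lemma eq_mod_blocks K X Y : block_diagonal X -> block_diagonal Y ->
  (forall nb : 'I_(nblocks d L),
     eq_mod K (block_sub d L nb X) (block_sub d L nb Y)) ->
  eq_mod K X Y.
Proof.
move=> Xb Yb XY; apply/eq_mod_coefP => i j k kK.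
have [|ij] := boolP (same_block d L i j); last by rewrite Xb ?Yb.
move=> /same_block_slice[nb [i' [j' [-> ->]]]].
by have /eq_mod_coefP/(_ i' j' k kK) := XY nb; rewrite !mxE.
Qed.

End Blocks.

(** * Entrywise meaning of the masks *)

Section Masks.
Variables (R : realType) (N : nat).
Implicit Types L X : 'M[{poly R}]_N.

Lemma hadamard_offdiagP d X :
  eq_mod d 0 (hadamard (P_L R N + P_R R N) (mxtrunc d X)) <->
  forall i j k, i != j -> (k < d)%N -> (X i j)`_k = 0.
Proof.
rewrite eq_mod_coefP; split=> [X0 i j k ij kd | X0 i j k kd].
  have := X0 i j k kd; rewrite !mxE coefZ coef_take_poly kd coef0 => /esym.
  by move: ij; rewrite -val_eqE /=; case: ltngtP; rewrite ?addr0 ?add0r ?mul1r.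
rewrite !mxE coefZ coef_take_poly kd coef0.
by have [->|ij] := eqVneq i j; [rewrite ltnn addr0 mul0r | rewrite X0 ?mulr0].
Qed.

Lemma hadamard_blockP d D L X :
  eq_mod D 0 (hadamard (P_b d L) X) <->
  forall i j k, ~~ same_block d L i j -> (k < D)%N -> (X i j)`_k = 0.
Proof.
rewrite eq_mod_coefP; split=> [X0 i j k ij kD | X0 i j k kD].
  by have := X0 i j k kD; rewrite !mxE coefZ ij mul1r coef0.
rewrite !mxE coefZ coef0; have [ij|ij] := boolP (same_block d L i j).
  by rewrite mul0r.
by rewrite X0 ?mulr0.
Qed.

Lemma block_sub_trunc d L nb K X :
  block_sub d L nb (mxtrunc K X) = mxtrunc K (block_sub d L nb X).
Proof. by apply/matrixP => i j; rewrite !mxE. Qed.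

End Masks.

(** * From level d to level d + 1 *)

Section Step.
Variables (R : realType) (N D d : nat) (A Lam Q Lam_hat Q_hat : 'M[{poly R}]_N).
Hypothesis d_lt_D : (d < D)%N.
Hypothesis eigh_d : is_eigh D d A Lam Q.
Hypothesis eigh_blocks : forall nb : 'I_(nblocks d Lam),
  is_eigh (D - d) 1 (block_sub d Lam nb (mxtail d Lam))
    (block_sub d Lam nb Lam_hat) (block_sub d Lam nb Q_hat).
Hypothesis off_blocks : forall i j : 'I_N, ~~ same_block d Lam i j ->
  forall k, (k < D - d)%N -> (Q_hat i j)`_k = 0 /\ (Lam_hat i j)`_k = 0.

Let K := (D - d)%N.
Let L0 := mxtrunc d Lam.
Let M := mxtrunc K (mxtail d Lam).
Let U := mxtrunc K Q_hat.
Let Lam_next := mxtrunc d Lam + 'X^d *: mxtrunc K Lam_hat.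

Let K_gt0 : (0 < K)%N. Proof. by rewrite subn_gt0. Qed.
Let dK : (d + K)%N = D. Proof. by rewrite subnKC // ltnW. Qed.
Let Lam_sorted : diag_sorted d Lam. Proof. exact: eigh_sorted eigh_d. Qed.

Lemma Lam_low_offdiag i j k : i != j -> (k < d)%N -> (Lam i j)`_k = 0.
Proof. by have /hadamard_offdiagP := eigh_low eigh_d; apply. Qed.

Lemma block_diagonal_trunc (X : 'M[{poly R}]_N) :
  (forall i j, ~~ same_block d Lam i j -> forall k, (k < K)%N -> (X i j)`_k = 0) ->
  block_diagonal d Lam (mxtrunc K X).
Proof.
move=> X0 i j ij; rewrite mxE; apply/polyP => k.
by rewrite coef_take_poly coef0; case: ltnP => // /(X0 i j ij).
Qed.

Lemma Q_hat_block_diagonal : block_diagonal d Lam U.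
Proof. by apply: block_diagonal_trunc => i j ij k /(off_blocks ij)[]. Qed.

Lemma Lam_hat_block_diagonal : block_diagonal d Lam (mxtrunc K Lam_hat).
Proof. by apply: block_diagonal_trunc => i j ij k /(off_blocks ij)[]. Qed.

Lemma tail_block_diagonal : block_diagonal d Lam M.
Proof.
apply: block_diagonal_trunc => i j ij k kK; rewrite mxE coef_drop_poly.
have /hadamard_blockP := eigh_block eigh_d; apply=> //.
by rewrite addnC -ltn_subRL.
Qed.

Lemma trunc_Lam_diag : L0 = diag_mx (\row_i take_poly d (Lam i i)).
Proof.
apply/matrixP => i j; rewrite !mxE; have [->|ij] := eqVneq i j.
  by rewrite mulr1n.
rewrite mulr0n; apply/polyP => k; rewrite coef_take_poly coef0.
by case: ltnP => // /(Lam_low_offdiag ij).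
Qed.

(** The diagonal of L0 takes a single value on each block. *)
Lemma trunc_Lam_comm (X : 'M[{poly R}]_N) : block_diagonal d Lam X -> L0 *m X = X *m L0.
Proof.
move=> Xb; rewrite trunc_Lam_diag mul_diag_mx mul_mx_diag; apply/matrixP => i j.
rewrite !mxE; have [|/Xb->] := boolP (same_block d Lam i j).
  by rewrite same_blockE // mulrC => /eqP->.
by rewrite mul0r mulr0.
Qed.

(** Block diagonal matrices multiply block by block, so the orthogonality of the
    diagonal blocks is that of the whole matrix. *)
Lemma Q_hat_orth : eq_mod K (U^T *m U) 1%:M.
Proof.
apply: (eq_mod_blocks (L := Lam) (d := d)).
- by apply: block_diagonalM => //; [apply: block_diagonal_tr => // |]; exact: Q_hat_block_diagonal.
- move=> i j ij; rewrite mxE; case: eqVneq ij => // ->.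
  by rewrite same_blockE // eqxx.
move=> nb; rewrite block_subM //; last by apply: block_diagonal_tr => //; exact: Q_hat_block_diagonal.
have -> : block_sub d Lam nb (1%:M : 'M[{poly R}]_N) = 1%:M.
  by apply/matrixP => i j; rewrite !mxE (inj_eq (@slice_inj _ _ _ _ _)).
have /eq_mod_sub0 := eigh_orth (eigh_blocks nb); apply: eq_mod_trans.
rewrite [block_sub _ _ _ U^T](_ : _ = (block_sub d Lam nb U)^T).
  by rewrite block_sub_trunc; apply: eq_modM; [apply: eq_mod_tr|]; exact: eq_mod_trunc.
by apply/matrixP => i j; rewrite !mxE.
Qed.

Lemma Q_hat_diagonalises_tail : eq_mod K (U^T *m M *m U) (mxtrunc K Lam_hat).
Proof.
have UTb : block_diagonal d Lam U^T.
  by apply: block_diagonal_tr => //; exact: Q_hat_block_diagonal.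
have UMb : block_diagonal d Lam (U^T *m M).
  by apply: block_diagonalM => //; exact: tail_block_diagonal.
apply: (eq_mod_blocks (L := Lam) (d := d)).
- by apply: block_diagonalM => //; exact: Q_hat_block_diagonal.
- exact: Lam_hat_block_diagonal.
move=> nb; rewrite !block_subM // !block_sub_trunc.
have /eq_mod_sub0 E := eigh_diag (eigh_blocks nb).
apply: (@eq_mod_trans _ _ _ _ (block_sub d Lam nb Lam_hat)); last first.
  exact/eq_mod_sym/eq_mod_trunc.
apply: eq_mod_trans E.
rewrite [block_sub _ _ _ U^T](_ : _ = (block_sub d Lam nb U)^T).
  rewrite block_sub_trunc; apply: eq_modM; last exact: eq_mod_trunc.
  by apply: eq_modM; [apply: eq_mod_tr|]; exact: eq_mod_trunc.
by apply/matrixP => i j; rewrite !mxE.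
Qed.

Lemma Lam_next_coef i j k : (Lam_next i j)`_k =
  if (k < d)%N then (Lam i j)`_k
  else if (k < D)%N then (Lam_hat i j)`_(k - d) else 0.
Proof.
rewrite !mxE coefD coefXnM !coef_take_poly.
case: ltnP => [|dk]; first by rewrite addr0.
by rewrite add0r ltn_sub2rE.
Qed.

Lemma Lam_next_take i : take_poly d (Lam_next i i) = take_poly d (Lam i i).
Proof.
by apply/polyP => k; rewrite !coef_take_poly Lam_next_coef; case: ltnP.
Qed.

Lemma Lam_next_at_d i j : (Lam_next i j)`_d = (Lam_hat i j)`_0.
Proof. by rewrite Lam_next_coef ltnn d_lt_D subnn. Qed.

(** Between two blocks the first d coefficients decide, as for Lam; inside a
    block they tie and the coefficient of order d decides, which is sorted by the
    level 1 subproblem. *)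
Lemma Lam_next_sorted : diag_sorted d.+1 Lam_next.
Proof.
move=> i j ij; rewrite lex_leS -lex_le_take !Lam_next_take lex_le_take.
rewrite Lam_sorted //= !Lam_next_at_d -same_blockE //; apply/implyP.
move=> /same_block_slice[nb [i' [j' [Ei Ej]]]].
have ij' : (i' <= j')%N by move: ij; rewrite Ei Ej /= leq_add2l.
have := eigh_sorted (eigh_blocks nb) ij'; rewrite lex_leS !mxE Ei Ej.
move=> /andP[_ /implyP]; apply; apply/eqP/polyP => k.
by rewrite !coef_take_poly.
Qed.

(** Two indices that are separated at level d + 1 are either separated at level
    d, where Lam_hat vanishes, or lie in one block of level d and are separated
    by the level 1 subproblem of that block. *)
Lemma Lam_next_block i j k : ~~ same_block d.+1 Lam_next i j -> (k < D)%N ->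
  (Lam_next i j)`_k = 0.
Proof.
move=> ij kD; rewrite Lam_next_coef kD.
have nij : i != j.
  by apply: contraNneq ij => ->; rewrite same_blockE ?eqxx //; exact: Lam_next_sorted.
case: ltnP => [kd|dk]; first exact: Lam_low_offdiag.
have kdK : (k - d < K)%N by rewrite ltn_sub2rE.
have [sij|sij] := boolP (same_block d Lam i j); last by have [] := off_blocks sij kdK.
have [nb [i' [j' [Ei Ej]]]] := same_block_slice sij.
have /hadamard_blockP/(_ i' j' (k - d)%N) := eigh_block (eigh_blocks nb).
rewrite mxE -Ei -Ej; apply=> //; apply: contra ij.
rewrite !same_blockE; [|exact: Lam_next_sorted|exact: eigh_sorted (eigh_blocks nb)].
move=> /eqP E; rewrite !mxE -Ei -Ej in E; apply/eqP; apply: take_polyS_eq.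
  by rewrite !Lam_next_take; apply/eqP; rewrite -same_blockE.
by rewrite !Lam_next_at_d; have := congr1 (coefp 0) E; rewrite /= !coef_take_poly.
Qed.

Lemma Lam_next_offdiag i j k : i != j -> (k < d.+1)%N -> (Lam_next i j)`_k = 0.
Proof.
move=> ij; rewrite ltnS leq_eqVlt => /predU1P[->|kd]; last first.
  by rewrite Lam_next_coef kd Lam_low_offdiag.
rewrite Lam_next_at_d; have [sij|sij] := boolP (same_block d Lam i j); last first.
  by have [] := off_blocks sij K_gt0.
have [nb [i' [j' [Ei Ej]]]] := same_block_slice sij.
have /hadamard_offdiagP/(_ i' j' 0%N) := eigh_low (eigh_blocks nb).
by rewrite mxE -Ei -Ej; apply=> //; apply: contraNneq ij => E; rewrite Ei Ej E.
Qed.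

(** L0 and the tail are conjugated separately.  For L0, commute and use
    orthogonality at full order D; for the tail, the factor T^d makes it enough
    to know S modulo T^(D - d). *)
Lemma Lam_next_diagonalised S :
  eq_mod K S U -> eq_mod D (S^T *m S) 1%:M -> eq_mod D (L0 *m S) (S *m L0) ->
  eq_mod D (S^T *m Lam *m S) Lam_next.
Proof.
move=> SU SS L0S; rewrite [Lam in X in eq_mod _ X](mxtrunc_tail d) -/L0.
rewrite mulmxDr mulmxDl; apply: eq_modD.
  rewrite -mulmxA; apply: (@eq_mod_trans _ _ _ _ (S^T *m (S *m L0))).
    by apply: eq_modM.
  by rewrite mulmxA -[X in eq_mod _ _ X]mul1mx; apply: eq_modM.
rewrite -scalemxAr -scalemxAl -dK; apply: eq_modXn.
apply: eq_mod_trans Q_hat_diagonalises_tail.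
apply: eq_modM => //; apply: eq_modM; first exact: eq_mod_tr.
exact/eq_mod_sym/eq_mod_trunc.
Qed.

End Step.

Theorem theorem3 (R : realType) (N D d : nat)
    (A Lam Q Lam_hat Q_hat : 'M[{poly R}]_N)
    (A_sym : eq_mod D A^T A)
    (d_lt_D : (d < D)%N)
    (eigh_d : is_eigh D d A Lam Q)
    (eigh_blocks : forall nb : 'I_(nblocks d Lam),
       is_eigh (D - d) 1 (block_sub d Lam nb (mxtail d Lam))
         (block_sub d Lam nb Lam_hat) (block_sub d Lam nb Q_hat))
    (off_blocks : forall i j : 'I_N,
       ~~ same_block d Lam i j ->
       forall k, (k < D - d)%N -> (Q_hat i j)`_k = 0 /\ (Lam_hat i j)`_k = 0) :
  exists dQ : 'M[{poly R}]_N,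
    let Q_step := mxtrunc (D - d) Q_hat + 'X^(D - d) *: mxtrunc d dQ in
    let Lam_next := mxtrunc d Lam + 'X^d *: mxtrunc (D - d) Lam_hat in
    let Q_next := Q *m Q_step in
    eq_mod D 0 (Q_step^T *m Q_step - 1%:M)
    /\ is_eigh D d.+1 A Lam_next Q_next.
Proof.
have K_gt0 : (0 < D - d)%N by rewrite subn_gt0.
set U := mxtrunc (D - d) Q_hat; set L0 := mxtrunc d Lam.
have L0T : L0^T = L0 by rewrite /L0 (trunc_Lam_diag eigh_d) tr_diag_mx.
have L0U : L0 *m U = U *m L0.
  exact: (trunc_Lam_comm eigh_d (Q_hat_block_diagonal off_blocks)).
have UU : eq_mod (D - d) (U^T *m U) 1%:M.
  exact: (Q_hat_orth eigh_d eigh_blocks off_blocks).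
have [W [WU L0W WW]] := orth_lift D L0T L0U K_gt0 UU.
exists (mxtail (D - d) W).
move=> S Lam_next Q_next.
(* W agrees with U below order D - d, so adding its tail to U gives W modulo T^D. *)
have SW : eq_mod D S W.
  have -> : S = mxtrunc D W; last exact: eq_mod_trunc.
  rewrite (mxtrunc_split _ (leq_subr d D)) /S subKn ?(ltnW d_lt_D) //.
  by rewrite (eq_mod_mxtrunc WU) /U; congr (_ + _); apply/esym/eq_mod_mxtrunc/eq_mod_trunc.
have SS : eq_mod D (S^T *m S) 1%:M.
  by apply: eq_mod_trans WW; apply: eq_modM => //; exact: eq_mod_tr.
have SU : eq_mod (D - d) S U.
  by apply: eq_mod_trans WU; apply: eq_mod_leq SW; exact: leq_subr.
have L0S : eq_mod D (L0 *m S) (S *m L0).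
  apply: (@eq_mod_trans _ _ _ _ (L0 *m W)); first exact: eq_modM.
  by rewrite L0W; apply: eq_modM => //; exact: eq_mod_sym.
split; first exact/eq_mod_sub0.
split=> //.
- apply/eq_mod_sub0; rewrite /Q_next trmx_mul.
  have -> : S^T *m Q^T *m A *m (Q *m S) = S^T *m (Q^T *m A *m Q) *m S.
    by rewrite !mulmxA.
  apply: (@eq_mod_trans _ _ _ _ (S^T *m Lam *m S)).
    do 2!apply: eq_modM => //; exact/eq_mod_sub0/(eigh_diag eigh_d).
  exact: (Lam_next_diagonalised d_lt_D eigh_d eigh_blocks off_blocks SU SS L0S).
- apply/eq_mod_sub0; rewrite /Q_next trmx_mul mulmxA -(mulmxA S^T).
  apply: eq_mod_trans SS; apply: eq_modM => //.
  rewrite -[X in eq_mod _ _ X]mulmx1; apply: eq_modM => //.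
  exact/eq_mod_sub0/(eigh_orth eigh_d).
- by apply/hadamard_offdiagP => i j k; apply: (Lam_next_offdiag d_lt_D eigh_d eigh_blocks off_blocks).
- by apply/hadamard_blockP => i j k; apply: (Lam_next_block d_lt_D eigh_d eigh_blocks off_blocks).
- exact: (Lam_next_sorted d_lt_D eigh_d eigh_blocks).
Qed.
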